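(* Let $a\ge 4$ and $r\in(0,1/2)$. There is a constant $C=C(a,r)>0$, depending only on $a$ and $r$, such that the following holds. Let $\lambda:[0,1]\to\mathbb{R}$ be a continuous function with $\lambda(1)=0$ and $\lambda(t)\ge a(1-t)^r$ for all $t\in[0,1]$. Let $(K_t)_{t\in[0,1]}$ be the Loewner hulls generated by $\lambda$, and let $p=\inf\{x : x\in K_1\cap\mathbb{R}\}$. Then near $p$, $K_1$ is contained in the region $\{x+iy : p\le x,\ 0\le y\le C(x-p)^{2-2r}\}$; that is, there is a neighborhood $U$ of $p$ in $\mathbb{C}$ such that $K_1\cap U\subset\{x+iy : p\le x,\ 0\le y\le C(x-p)^{2-2r}\}$.
   Context: $\mathbb{H}$ denotes the open upper half-plane. A driving function is a continuous real-valued function $\lambda$ on $[0,T]$. For $z\in\overline{\mathbb{H}}$ let $g_t(z)$ solve the chordal Loewner equation $\partial_t g_t(z)=\frac{2}{g_t(z)-\lambda(t)}$, $g_0(z)=z$, which for $z\ne\lambda(0)$ has a unique solution as long as the denominator stays non-zero. The Loewner hulls generated (driven) by $\lambda$ are $K_t=\{z\in\overline{\mathbb{H}} : g_s(z)=\lambda(s)\text{ for some }s\in[0,t]\}$, i.e. the set of initial values for which the denominator reaches zero (in the limit) at some time $s\le t$ (with $\lambda(0)$ included). In particular $K_t$ may contain points of $\mathbb{R}$. *)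

(* Defs.v *)
From Stdlib Require Import Reals.
From Coquelicot Require Import Coquelicot.
Open Scope R_scope.

(** Real powers of nonnegative bases.  [Rpower] cannot be used directly, since
    [Rpower 0 y = 1]; here [rpow 0 y = 0], as needed for exponents [y > 0]. *)
Definition rpow (x y : R) : R := if Rlt_dec 0 x then Rpower x y else 0.

(** [g] solves the chordal Loewner equation on [[0,s)] with [g 0 = z].  The
    derivative is taken relative to [[0,+oo)], so that it is the right
    derivative at [t = 0] and the ordinary one for [0 < t]. *)
Definition loewner_solution (lambda : R -> R) (z : C) (s : R) (g : R -> C)
  : Prop :=
  g 0 = z /\
  forall t : R, 0 <= t < s ->
    (g t - lambda t <> 0)%C /\
    filterdiff (K := R_AbsRing) (V := C_R_NormedModule) g
      (within (fun u : R => 0 <= u) (locally t))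
      (fun h : R => scal h (2 / (g t - lambda t))%C).

(** The hull [K_t]: the initial value [z] belongs to it if the denominator
    [g_u(z) - lambda(u)] vanishes at time [0] or tends to zero at some time
    [0 < s <= t] up to which the solution exists. *)
Definition loewner_hull (lambda : R -> R) (t : R) (z : C) : Prop :=
  0 <= Im z /\
  (z = RtoC (lambda 0) \/
   exists (s : R) (g : R -> C),
     0 < s <= t /\
     loewner_solution lambda z s g /\
     filterlim (fun u : R => (g u - lambda u)%C) (at_left s)
       (locally (RtoC 0))).

(* Main.v *)
Require Import Defs.
From Stdlib Require Import Reals Lra PSeries_reg.
From Coquelicot Require Import Coquelicot.
Open Scope R_scope.

(** The theorem holds because the leftmost swallowed point [p] is followed by
    a real trajectory [P] of the Loewner flow that stays far from the driving
    function, at distance at least [2 (1 - t)^r], and [(1 - t)^(-2r)] is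
    integrable: until the very end the flow near [p] is an almost rigid motion.

    Existence of [P].  In the remaining time [tau = 1 - t] one looks for a
    solution starting from [0] of [Q' = 2 / (mu - Q)], where
    [mu tau = lambda (1 - tau) >= 4 tau^r].  The barrier [2 tau^(1-r)] is
    preserved, because below it [mu - Q >= 2 tau^r] and hence
    [Q' <= tau^(-r) <= (2 tau^(1-r))'].  The field is singular at [tau = 0],
    but there its Lipschitz constant in [Q] is at most [tau^(-2r) / 2], so
    Picard iteration converges geometrically against an exponential of
    [tau^(1-2r)] ([picard_increment]).  The limit gives [P]
    ([exists_boundary_flow]); [P 0] belongs to the hull since [P] meets
    [lambda] at time [1].

    Comparison with [P].  For a solution [g] from [z] put [U + iV = g - P] and
    [L = lambda - P].  Then [D = U + iV] satisfies [D' = -2 D / (L (L - D))], and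
    [z] is swallowed exactly when [D] reaches [L].

    - A point with [Re z < P 0] and relatively small [Im z] is never swallowed
      ([not_swallowed_on_the_left]): as long as [|V| <= |U|], the quantity [-U]
      decreases at relative rate at most [4 / L^2], so it keeps a fixed
      proportion of its initial value, while [V] does not grow.  For real [z]
      this shows that [P 0] is the infimum [p].

    - If [rho = |z - p|], then [|D| <= rho <= L / 2] up to remaining time
      [rho^(1/r)].  So [z] is not swallowed before, [V] has lost only a bounded
      factor by then, and since [V^2] decreases at speed at most [4] what is
      left of [V^2] is at most [4 rho^(1/r)] ([swallowed_height_bound]).  Thus
      [Im z <= C rho^(1/(2r)) <= C rho^(2-2r)], the exponents being ordered by
      [4 r (1 - r) <= 1].

    Since [2 - 2 r > 1], the second estimate makes [Im z] much smaller than
    [rho] near [p], so the first one applies, puts [z] to the right of [p], and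
    makes [rho] comparable to [Re z - p]. *)

(** * Real powers *)

Lemma exp_le x y : x <= y -> exp x <= exp y.
Proof. intros [H|H]; [apply Rlt_le, exp_increasing, H | subst; lra]. Qed.

Lemma rpow_pos x y : 0 < x -> rpow x y = Rpower x y.
Proof. intros H; unfold rpow; destruct (Rlt_dec 0 x); [reflexivity | contradiction]. Qed.

Lemma rpow_gt_0 x y : 0 < x -> 0 < rpow x y.
Proof. intros H; rewrite rpow_pos by exact H; apply exp_pos. Qed.

Lemma rpow_ge_0 x y : 0 <= rpow x y.
Proof.
  unfold rpow; destruct (Rlt_dec 0 x); [apply Rlt_le, exp_pos | lra].
Qed.

Lemma rpow_nonpos x y : x <= 0 -> rpow x y = 0.
Proof. intros H; unfold rpow; destruct (Rlt_dec 0 x); lra. Qed.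

Lemma rpow_1 y : rpow 1 y = 1.
Proof. rewrite rpow_pos by lra. unfold Rpower. rewrite ln_1, Rmult_0_r. apply exp_0. Qed.

Lemma rpow_plus x y z : 0 < x -> rpow x (y + z) = rpow x y * rpow x z.
Proof. intros H; rewrite !rpow_pos by exact H; apply Rpower_plus. Qed.

Lemma rpow_base_le x1 x2 y : 0 <= y -> x1 <= x2 -> rpow x1 y <= rpow x2 y.
Proof.
  intros Hy Hx. destruct (Rlt_le_dec 0 x1) as [H|H].
  - rewrite !rpow_pos by lra. apply Rle_Rpower_l; lra.
  - rewrite rpow_nonpos by exact H. apply rpow_ge_0.
Qed.

Lemma rpow_neg_double x y : 0 < x -> rpow x (- (2 * y)) * (rpow x y * rpow x y) = 1.
Proof.
  intros H. rewrite <- !rpow_plus by exact H. replace (- (2 * y) + (y + y)) with 0 by ring.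
  rewrite rpow_pos by exact H. apply Rpower_O, H.
Qed.

Lemma rpow_exponent_le x y1 y2 : 0 <= x <= 1 -> y1 <= y2 -> rpow x y2 <= rpow x y1.
Proof.
  intros Hx Hy. destruct (Rlt_le_dec 0 x) as [H|H].
  - rewrite !rpow_pos by exact H. unfold Rpower. apply exp_le.
    assert (ln x <= 0) by (rewrite <- ln_1; apply ln_le; lra). nra.
  - rewrite !rpow_nonpos by exact H; lra.
Qed.

Lemma rpow_le_1 x y : 0 <= x <= 1 -> 0 <= y -> rpow x y <= 1.
Proof. intros Hx Hy. rewrite <- (rpow_1 y). apply rpow_base_le; lra. Qed.

Lemma is_derive_rpow x y : 0 < x -> is_derive (fun u => rpow u y) x (y * rpow x (y - 1)).
Proof.
  intros H. rewrite rpow_pos by exact H.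
  apply is_derive_ext_loc with (f := fun u => Rpower u y).
  - exists (mkposreal x H). intros u Hu.
    change (Rabs (u - x) < x) in Hu. apply Rabs_def2 in Hu.
    rewrite rpow_pos; [reflexivity | lra].
  - apply is_derive_Reals, derivable_pt_lim_power, H.
Qed.

Lemma continuous_rpow x y : 0 < y -> continuous (fun u => rpow u y) x.
Proof.
  intros Hy. destruct (Rlt_le_dec 0 x) as [H|H].
  - apply (ex_derive_continuous (fun u => rpow u y)). eexists. apply is_derive_rpow, H.
  - apply filterlim_locally. intros eps. rewrite (rpow_nonpos x) by exact H.
    set (d := Rpower eps (/ y)).
    exists (mkposreal d (exp_pos _)). intros u Hu. change (Rabs (u - x) < d) in Hu.
    apply Rabs_def2 in Hu. change (Rabs (rpow u y - 0) < eps).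
    rewrite Rminus_0_r, Rabs_pos_eq by apply rpow_ge_0.
    destruct (Rlt_le_dec 0 u) as [Hu0|Hu0].
    + rewrite rpow_pos by exact Hu0.
      replace (pos eps) with (Rpower d y).
      * apply Rlt_Rpower_l; lra.
      * unfold d. rewrite Rpower_mult, Rinv_l by lra. apply Rpower_1, cond_pos.
    + rewrite rpow_nonpos by exact Hu0. apply cond_pos.
Qed.

(** * Monotonicity and continuous induction *)

Lemma le_of_derive_nonneg (f df : R -> R) (a b : R) :
  a <= b ->
  (forall x, a < x < b -> is_derive f x (df x)) ->
  (forall x, a <= x <= b -> continuous f x) ->
  (forall x, a < x < b -> 0 <= df x) ->
  f a <= f b.
Proof.
  intros Hab Hd Hc Hp.
  (* the mean value may be an endpoint, where [df] is not controlled *)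
  destruct (MVT_gen f a b (fun x => if Rlt_dec a x then if Rlt_dec x b then df x else 0 else 0))
    as [c [_ Hfc]]; rewrite ?Rmin_left, ?Rmax_right by lra.
  - intros x Hx. destruct (Rlt_dec a x); [destruct (Rlt_dec x b)|]; try lra. now apply Hd.
  - intros x Hx. apply continuity_pt_filterlim, Hc, Hx.
  - destruct (Rlt_dec a c); [destruct (Rlt_dec c b)|]; try lra.
    assert (0 <= df c) by (apply Hp; lra). nra.
Qed.

(** The bootstrap principle: a bound that follows at each time from the bound
    at all earlier times holds throughout.  At the supremum of the times up to
    which the bound holds, the hypothesis gives it and continuity extends it. *)
Lemma continuous_induction_lt (f : R -> R) (k T : R) :
  (forall t, 0 <= t < T -> continuous f t) ->
  (forall t, 0 <= t < T -> (forall u, 0 <= u < t -> f u < k) -> f t < k) ->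
  forall t, 0 <= t < T -> f t < k.
Proof.
  intros Hc Hstep t1 Ht1.
  destruct (Rlt_le_dec (f t1) k) as [H|Hbad]; [exact H | exfalso].
  set (E := fun t => 0 <= t <= t1 /\ forall u, 0 <= u <= t -> f u < k).
  assert (E0 : E 0).
  { split; [lra|]. intros u Hu. replace u with 0 by lra.
    apply Hstep; [lra | intros; lra]. }
  destruct (completeness E) as [m [Hub Hlub]].
  { exists t1. intros t [Ht _]. lra. }
  { now exists 0. }
  assert (Hm : 0 <= m <= t1).
  { split; [apply Hub, E0 | apply Hlub; intros t [Ht _]; lra]. }
  assert (Hbelow : forall u, 0 <= u < m -> f u < k).
  { intros u Hu. destruct (Rlt_le_dec (f u) k) as [H|H]; [exact H | exfalso].
    assert (m <= u); [|lra]. apply Hlub. intros t [Ht Et].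
    destruct (Rle_lt_dec t u) as [|Hut]; [assumption|].
    assert (f u < k) by (apply Et; lra). lra. }
  assert (Hfm : f m < k) by (apply Hstep; [lra | exact Hbelow]).
  assert (Hmt : m < t1).
  { destruct (Rle_lt_or_eq_dec m t1) as [|He]; [lra | assumption | subst m; lra]. }
  (* continuity pushes the bound strictly beyond the supremum *)
  assert (Hloc : locally m (fun u => f u < k)).
  { refine (Hc m _ (fun v => v < k) _); [lra | exact (open_lt k _ Hfm)]. }
  destruct Hloc as [d Hd].
  set (m' := Rmin t1 (m + d / 2)).
  assert (Hd0 := cond_pos d).
  assert (m < m') by (unfold m'; apply Rmin_case; lra).
  assert (m' <= t1) by apply Rmin_l.
  assert (m' <= m + d / 2) by apply Rmin_r.
  assert (m' <= m); [|lra].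
  apply Hub. split; [lra|]. intros u Hu.
  destruct (Rlt_le_dec u m) as [Hum|Hum]; [apply Hbelow; lra|].
  apply Hd. change (Rabs (u - m) < d). rewrite Rabs_pos_eq; lra.
Qed.

Lemma is_derive_rpow_remaining t y : t < 1 ->
  is_derive (fun u => rpow (1 - u) y) t (- (y * rpow (1 - t) (y - 1))).
Proof.
  intros Ht. evar_last.
  - apply (is_derive_comp (fun v => rpow v y) (fun u => 1 - u)).
    + apply is_derive_rpow; lra.
    + instantiate (1 := -1). auto_derive; [exact I | ring].
  - change (-1 * (y * rpow (1 - t) (y - 1)) = - (y * rpow (1 - t) (y - 1))). ring.
Qed.

(** A relative rate of decay [c (1 - t)^(-2r)] has integral at most
    [c / (1 - 2r)] over the whole unit interval, so it can only cost a bounded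
    factor, even up to time [1].  The weight
    [exp (- c (1 - t)^(1-2r) / (1 - 2r))] makes the product with [f] nondecreasing. *)
Lemma singular_gronwall (r c b : R) (f df : R -> R) :
  0 < r < 1 / 2 -> 0 <= c -> 0 <= b <= 1 ->
  (forall t, 0 <= t <= b -> continuous f t) ->
  (forall t, 0 < t < b -> is_derive f t (df t)) ->
  (forall t, 0 < t < b -> - (c * rpow (1 - t) (- (2 * r)) * f t) <= df t) ->
  0 <= f 0 ->
  f 0 * exp (- (c / (1 - 2 * r))) <= f b.
Proof.
  intros Hr Hc Hb Hcont Hd Hle H0.
  set (k := c / (1 - 2 * r)).
  assert (Hk : 0 <= k) by (apply Rdiv_le_0_compat; lra).
  set (e := fun t => exp (- k * rpow (1 - t) (1 - 2 * r))).
  assert (Hce : forall t, continuous e t).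
  { intros t. unfold e.
    apply (continuous_comp (fun u => - k * rpow (1 - u) (1 - 2 * r)) exp);
      [|apply continuous_exp].
    apply (continuous_scal_r (- k) (fun u => rpow (1 - u) (1 - 2 * r))).
    apply (continuous_comp (fun u => 1 - u) (fun v => rpow v (1 - 2 * r))).
    - apply (continuous_minus (fun _ => 1) (fun u => u));
        [apply continuous_const | apply continuous_id].
    - apply continuous_rpow; lra. }
  assert (Hmono : f 0 * e 0 <= f b * e b).
  { apply le_of_derive_nonneg with
      (f := fun t => f t * e t)
      (df := fun t => df t * e t + f t * (c * rpow (1 - t) (- (2 * r)) * e t)); [lra|..].
    - intros t Ht. apply (Derive.is_derive_mult f e); [now apply Hd|].
      unfold e. evar_last.
      + apply (is_derive_comp exp (fun u => - k * rpow (1 - u) (1 - 2 * r))).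
        * apply is_derive_exp.
        * apply is_derive_scal, is_derive_rpow_remaining; lra.
      + match goal with |- ?l = ?rr => change (l = rr) end.
        unfold scal; simpl; unfold mult; simpl.
        replace (1 - 2 * r - 1) with (- (2 * r)) by ring.
        unfold k. field. lra.
    - intros t Ht. apply (continuous_mult f e); [now apply Hcont | apply Hce].
    - intros t Ht. assert (0 < e t) by apply exp_pos.
      specialize (Hle t Ht).
      replace (df t * e t + f t * (c * rpow (1 - t) (- (2 * r)) * e t))
        with (e t * (df t + c * rpow (1 - t) (- (2 * r)) * f t)) by ring.
      apply Rmult_le_pos; lra. }
  assert (He0 : e 0 = exp (- k)).
  { unfold e. rewrite Rminus_0_r, rpow_1. f_equal; ring. }
  assert (Heb : e b <= 1).
  { apply Rle_trans with (exp 0); [|rewrite exp_0; lra]. apply exp_le.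
    assert (0 <= rpow (1 - b) (1 - 2 * r)) by apply rpow_ge_0. nra. }
  assert (0 < e b) by apply exp_pos. rewrite He0 in Hmono.
  assert (0 < exp (- k)) by apply exp_pos.
  assert (0 <= f 0 * exp (- k)) by (apply Rmult_le_pos; lra).
  assert (0 <= f b) by (destruct (Rle_lt_dec 0 (f b)); nra).
  assert (f b * e b <= f b) by nra. lra.
Qed.

(** * The flow relative to a boundary trajectory *)

(** The motion [U + iV = g - P] of a swallowed point seen from a boundary
    trajectory [P], with [L = lambda - P].  The equations are the real and
    imaginary parts of [D' = -2 D / (L (L - D))].  The last field is the weak form
    of [D - L] tending to [0] at time [s] that the estimates use; it avoids
    values at time [s] itself. *)
Record swallowed_flow (r s : R) (U V L : R -> R) : Prop := {
  sf_time : 0 < s <= 1;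
  sf_gap : forall t, 0 <= t < s -> 2 * rpow (1 - t) r <= L t;
  sf_cont : forall t, 0 <= t < s -> continuous U t /\ continuous V t;
  sf_derive_U : forall t, 0 < t < s ->
    is_derive U t
      (2 * ((U t - L t) * U t + V t ^ 2) / (L t * ((L t - U t) ^ 2 + V t ^ 2)));
  sf_derive_V : forall t, 0 < t < s ->
    is_derive V t (- (2 * V t / ((L t - U t) ^ 2 + V t ^ 2)));
  sf_nonzero : forall t, 0 <= t < s -> 0 < (L t - U t) ^ 2 + V t ^ 2;
  sf_swallowed : forall eps t0, 0 < eps -> t0 < s ->
    exists t, t0 < t < s /\ 0 <= t /\ Rabs (L t - U t) < eps /\ Rabs (V t) < eps
}.

Lemma sf_gap_pos r s U V L : swallowed_flow r s U V L ->
  forall t, 0 <= t < s -> 0 < L t.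
Proof.
  intros H t Ht. assert (Hs := sf_time _ _ _ _ _ H).
  assert (Hg := sf_gap _ _ _ _ _ H t Ht).
  assert (0 < rpow (1 - t) r) by (apply rpow_gt_0; lra). lra.
Qed.

Lemma sf_inv_gap_sq r s U V L : swallowed_flow r s U V L ->
  forall t, 0 <= t < s -> 4 / L t ^ 2 <= rpow (1 - t) (- (2 * r)).
Proof.
  intros H t Ht. assert (Hs := sf_time _ _ _ _ _ H).
  assert (Hg := sf_gap _ _ _ _ _ H t Ht).
  assert (Hp : 0 < rpow (1 - t) r) by (apply rpow_gt_0; lra).
  assert (Hq : 0 < rpow (1 - t) (- (2 * r))) by (apply rpow_gt_0; lra).
  assert (He : rpow (1 - t) (- (2 * r)) * (rpow (1 - t) r * rpow (1 - t) r) = 1).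
  { apply rpow_neg_double; lra. }
  apply Rle_div_l; [nra|].
  assert (4 * (rpow (1 - t) r * rpow (1 - t) r) <= L t ^ 2) by nra. nra.
Qed.

Lemma is_derive_sq (f : R -> R) x l :
  is_derive f x l -> is_derive (fun t => f t ^ 2) x (2 * f x * l).
Proof.
  intros H. replace (2 * f x * l) with (INR 2 * l * f x ^ Nat.pred 2) by (simpl; ring).
  now apply is_derive_pow.
Qed.

Lemma continuous_sq (f : R -> R) x :
  continuous f x -> continuous (fun t => f t ^ 2) x.
Proof.
  intros H. apply continuous_ext with (fun t => f t * f t).
  - intros t. change (@eq R (f t * f t) (f t ^ 2)). ring.
  -
  now apply (continuous_mult f f).
Qed.

Lemma sf_height_decreases r s U V L : swallowed_flow r s U V L ->
  forall t, 0 <= t < s -> V t ^ 2 <= V 0 ^ 2.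
Proof.
  intros H t Ht. apply Ropp_le_cancel.
  apply le_of_derive_nonneg with (f := fun u => - V u ^ 2)
    (df := fun u => - (2 * V u * (- (2 * V u / ((L u - U u) ^ 2 + V u ^ 2))))); [lra|..].
  - intros u Hu. apply (is_derive_opp (fun x => V x ^ 2)), is_derive_sq.
    apply (sf_derive_V _ _ _ _ _ H); lra.
  - intros u Hu. apply (continuous_opp (fun x => V x ^ 2)), continuous_sq.
    apply (sf_cont _ _ _ _ _ H); lra.
  - intros u Hu. assert (0 < (L u - U u) ^ 2 + V u ^ 2) by (apply (sf_nonzero _ _ _ _ _ H); lra).
    replace (- (2 * V u * - (2 * V u / ((L u - U u) ^ 2 + V u ^ 2))))
      with (4 * V u ^ 2 / ((L u - U u) ^ 2 + V u ^ 2)) by (field; lra).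
    apply Rdiv_le_0_compat; nra.
Qed.

(** While [U < - V 0 <= - |V|] one has [(U - L) U + V^2 <= 2 |U| (L + |U|)], so
    [-U] decays at relative rate at most [4 / L^2 <= (1 - t)^(-2r)] and keeps the
    proportion [exp (- 1 / (1 - 2r))] of its initial value.  That is still more
    than [V 0], so the situation persists, and [U] cannot reach [L > 0]. *)
Lemma not_swallowed_on_the_left r s U V L :
  0 < r < 1 / 2 -> swallowed_flow r s U V L ->
  U 0 < 0 -> 0 <= V 0 ->
  V 0 < - U 0 * exp (- (1 / (1 - 2 * r))) -> False.
Proof.
  intros Hr H HU0 HV0 Hsmall.
  assert (Hs := sf_time _ _ _ _ _ H).
  set (q := exp (- (1 / (1 - 2 * r)))) in *.
  assert (Hq : 0 < q) by apply exp_pos.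
  assert (Hstep : forall t, 0 <= t < s -> (forall u, 0 <= u < t -> U u < - V 0) ->
    - U 0 * q <= - U t).
  { intros t Ht Hu.
    apply (singular_gronwall r 1 t (fun u => - U u)
      (fun u => - (2 * ((U u - L u) * U u + V u ^ 2) / (L u * ((L u - U u) ^ 2 + V u ^ 2)))));
      try lra.
    - intros u Hut. apply (continuous_opp U). apply (sf_cont _ _ _ _ _ H); lra.
    - intros u Hut. apply (is_derive_opp U). apply (sf_derive_U _ _ _ _ _ H); lra.
    - intros u Hut.
      assert (HL := sf_gap_pos _ _ _ _ _ H u ltac:(lra)).
      assert (HG := sf_inv_gap_sq _ _ _ _ _ H u ltac:(lra)).
      assert (HVu := sf_height_decreases _ _ _ _ _ H u ltac:(lra)).
      specialize (Hu u ltac:(lra)).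
      assert (HVU : V u ^ 2 <= U u ^ 2) by nra.
      set (x := - U u) in *. assert (Hx : 0 < x) by (unfold x; lra).
      replace (U u) with (- x) in * by (unfold x; ring).
      apply Rle_trans with (- (4 / L u ^ 2 * x)); [nra|].
      apply Ropp_le_contravar.
      apply Rle_trans with (2 * (2 * x * (L u + x)) / (L u * ((L u + x) ^ 2))).
      + unfold Rdiv. apply Rmult_le_compat.
        * nra.
        * apply Rlt_le, Rinv_0_lt_compat, Rmult_lt_0_compat; nra.
        * nra.
        * apply Rinv_le_contravar; [apply Rmult_lt_0_compat; nra|].
          apply Rmult_le_compat_l; nra.
      + replace (2 * (2 * x * (L u + x)) / (L u * (L u + x) ^ 2))
          with (4 * x / (L u * (L u + x))) by (field; lra).
        replace (4 / L u ^ 2 * x) with (4 * x / (L u * L u)) by (field; lra).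
        unfold Rdiv. apply Rmult_le_compat_l; [lra|].
        apply Rinv_le_contravar; nra. }
  assert (Hleft : forall t, 0 <= t < s -> U t < - V 0).
  { apply (continuous_induction_lt U (- V 0) s).
    - intros t Ht. apply (sf_cont _ _ _ _ _ H); lra.
    - intros t Ht Hu. specialize (Hstep t Ht Hu). lra. }
  destruct (sf_swallowed _ _ _ _ _ H (- U 0 * q) 0) as [t [Ht [_ [Hlim _]]]]; [nra | lra |].
  assert (HL := sf_gap_pos _ _ _ _ _ H t ltac:(lra)).
  assert (- U 0 * q <= - U t) by (apply Hstep; [lra | intros; apply Hleft; lra]).
  apply Rabs_def2 in Hlim. lra.
Qed.

(** The squared modulus [N] of [U + iV] has the derivative
    [-4 N (L - U) / (L |L - D|^2)], which is nonpositive as long as [U <= L].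
    Up to remaining time [tau = rho^(1/r)] this keeps [|D| <= rho <= L / 2],
    whence the decay rate of [V^2] is at most [16 / L^2 <= 4 (1 - t)^(-2r)].
    Afterwards [V^2] decreases at speed at most [4], so reaching [0] within the
    time [tau] forces [V^2 <= 4 tau]. *)
Lemma swallowed_height_bound r s U V L rho :
  0 < r < 1 / 2 -> swallowed_flow r s U V L ->
  0 < rho < 1 -> U 0 ^ 2 + V 0 ^ 2 = rho ^ 2 ->
  V 0 ^ 2 * exp (- (4 / (1 - 2 * r))) <= 4 * rpow rho (1 / r).
Proof.
  intros Hr H Hrho HN0.
  assert (Hs := sf_time _ _ _ _ _ H).
  set (tau := rpow rho (1 / r)).
  assert (Hir : 0 < 1 / r) by (apply Rdiv_lt_0_compat; lra).
  assert (Htau : 0 < tau < 1).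
  { split; [apply rpow_gt_0; lra|]. unfold tau.
    apply Rlt_le_trans with (rpow 1 (1 / r)); [|rewrite rpow_1; lra].
    rewrite !rpow_pos by lra. apply Rlt_Rpower_l; lra. }
  assert (Htr : rpow tau r = rho).
  { unfold tau. rewrite (rpow_pos _ r), rpow_pos, Rpower_mult by (apply Htau || lra).
    replace (1 / r * r) with 1 by (field; lra). apply Rpower_1; lra. }
  (* [tau] solves [tau^r = rho], so that [L >= 2 rho] up to time [t1] *)
  set (t1 := 1 - tau).
  assert (Hgap : forall t, 0 <= t <= t1 -> t < s -> 2 * rho <= L t).
  { intros t Ht Hts. apply Rle_trans with (2 * rpow (1 - t) r).
    - rewrite <- Htr. apply Rmult_le_compat_l; [lra|].
      apply rpow_base_le; unfold t1 in Ht; lra.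
    - apply (sf_gap _ _ _ _ _ H); lra. }
  set (N := fun t => U t ^ 2 + V t ^ 2).
  assert (HNc : forall t, 0 <= t < s -> continuous N t).
  { intros t Ht. destruct (sf_cont _ _ _ _ _ H t Ht).
    apply (continuous_plus (fun u => U u ^ 2) (fun u => V u ^ 2)); now apply continuous_sq. }
  set (dN := fun t => - (4 * N t * (L t - U t) / (L t * ((L t - U t) ^ 2 + V t ^ 2)))).
  assert (HNd : forall t, 0 < t < s -> is_derive N t (dN t)).
  { intros t Ht. evar_last.
    - apply (is_derive_plus (fun u => U u ^ 2) (fun u => V u ^ 2)).
      + apply is_derive_sq, (sf_derive_U _ _ _ _ _ H), Ht.
      + apply is_derive_sq, (sf_derive_V _ _ _ _ _ H), Ht.
    - assert (HL := sf_gap_pos _ _ _ _ _ H t ltac:(lra)).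
      assert (Hnz := sf_nonzero _ _ _ _ _ H t ltac:(lra)).
      unfold plus; simpl. unfold dN, N. field. split; [|lra]. simpl in Hnz. lra. }
  assert (HNstep : forall t, 0 <= t <= t1 -> t < s ->
    (forall u, 0 <= u < t -> N u < 4 * rho ^ 2) -> N t <= rho ^ 2).
  { intros t Ht Hts Hu. rewrite <- HN0. apply Ropp_le_cancel.
    apply le_of_derive_nonneg with (f := fun u => - N u) (df := fun u => - dN u); [lra|..].
    - intros u Hut. apply (is_derive_opp N), HNd; lra.
    - intros u Hut. apply (continuous_opp N), HNc; lra.
    - intros u Hut. specialize (Hu u ltac:(lra)). specialize (Hgap u ltac:(lra) ltac:(lra)).
      assert (Hnz := sf_nonzero _ _ _ _ _ H u ltac:(lra)).
      unfold dN. rewrite Ropp_involutive.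
      assert (0 <= N u) by (unfold N; nra).
      assert (U u <= 2 * rho) by (unfold N in Hu; nra).
      apply Rdiv_le_0_compat; [nra | apply Rmult_lt_0_compat; lra]. }
  assert (HN : forall t, 0 <= t <= t1 -> t < s -> N t <= rho ^ 2).
  { intros t Ht Hts. apply HNstep; [assumption.. |].
    intros u Hu. apply (continuous_induction_lt N _ t); [| | lra].
    - intros v Hv. apply HNc; lra.
    - intros v Hv Hv'. assert (N v <= rho ^ 2) by (apply HNstep; [lra | lra | exact Hv']).
      nra. }
  assert (HU : forall t, 0 <= t <= t1 -> t < s -> U t <= rho).
  { intros t Ht Hts. specialize (HN t Ht Hts). unfold N in HN. nra. }
  assert (Ht1s : t1 < s).
  { destruct (Rlt_le_dec t1 s) as [Hlt|Hle]; [exact Hlt | exfalso].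
    destruct (sf_swallowed _ _ _ _ _ H rho 0) as [t [Ht [_ [Hlim _]]]]; [lra | lra |].
    specialize (HU t ltac:(lra) ltac:(lra)). specialize (Hgap t ltac:(lra) ltac:(lra)).
    apply Rabs_def2 in Hlim. lra. }
  assert (Hearly : V 0 ^ 2 * exp (- (4 / (1 - 2 * r))) <= V t1 ^ 2).
  { apply (singular_gronwall r 4 t1 (fun u => V u ^ 2)
      (fun u => 2 * V u * (- (2 * V u / ((L u - U u) ^ 2 + V u ^ 2))))); try lra.
    - unfold t1; lra.
    - intros u Hu. apply continuous_sq, (sf_cont _ _ _ _ _ H); lra.
    - intros u Hu. apply is_derive_sq, (sf_derive_V _ _ _ _ _ H); lra.
    - intros u Hu. specialize (HU u ltac:(lra) ltac:(lra)).
      specialize (Hgap u ltac:(lra) ltac:(lra)).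
      assert (Hnz := sf_nonzero _ _ _ _ _ H u ltac:(lra)).
      assert (HG := sf_inv_gap_sq _ _ _ _ _ H u ltac:(lra)).
      apply Rle_trans with (- (4 * (4 / L u ^ 2) * V u ^ 2)); [nra|].
      replace (2 * V u * - (2 * V u / ((L u - U u) ^ 2 + V u ^ 2)))
        with (- (4 * V u ^ 2 * / ((L u - U u) ^ 2 + V u ^ 2))) by (field; lra).
      apply Ropp_le_contravar.
      replace (4 * (4 / L u ^ 2) * V u ^ 2) with (4 * V u ^ 2 * / (L u ^ 2 / 4))
        by (field; lra).
      apply Rmult_le_compat_l; [nra|]. apply Rinv_le_contravar; nra.
    - nra. }
  assert (Hlate : V t1 ^ 2 <= 4 * tau).
  { apply Rle_plus_epsilon. intros eps Heps.
    destruct (sf_swallowed _ _ _ _ _ H (Rmin 1 eps) t1) as [t [Ht [Ht0 [_ Hlim]]]];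
      [apply Rmin_pos; lra | lra |].
    assert (Hm1 := Rmin_l 1 eps). assert (Hm2 := Rmin_r 1 eps).
    apply Rabs_def2 in Hlim.
    assert (Hmono : V t1 ^ 2 + 4 * t1 <= V t ^ 2 + 4 * t).
    { apply le_of_derive_nonneg with (f := fun u => V u ^ 2 + 4 * u)
        (df := fun u => 2 * V u * (- (2 * V u / ((L u - U u) ^ 2 + V u ^ 2))) + 4); [lra|..].
      - intros u Hu. apply (is_derive_plus (fun u => V u ^ 2) (fun u => 4 * u)).
        + apply is_derive_sq, (sf_derive_V _ _ _ _ _ H); unfold t1 in *; lra.
        + auto_derive; [exact I | ring].
      - intros u Hu. apply (continuous_plus (fun u => V u ^ 2) (fun u => 4 * u)).
        + apply continuous_sq, (sf_cont _ _ _ _ _ H); unfold t1 in *; lra.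
        + apply (continuous_mult (fun _ => 4) (fun v : R => v));
            [apply continuous_const | apply continuous_id].
      - intros u Hu.
        assert (Hnz := sf_nonzero _ _ _ _ _ H u ltac:(unfold t1 in *; lra)).
        replace (2 * V u * - (2 * V u / ((L u - U u) ^ 2 + V u ^ 2)) + 4)
          with (4 * (L u - U u) ^ 2 / ((L u - U u) ^ 2 + V u ^ 2)) by (field; lra).
        apply Rdiv_le_0_compat; [|exact Hnz].
        assert (0 <= (L u - U u) ^ 2) by apply pow2_ge_0. lra. }
    set (m := Rmin 1 eps) in *.
    assert (0 < (m - V t) * (m + V t)) by (apply Rmult_lt_0_compat; lra).
    assert (m * m <= m * 1) by (apply Rmult_le_compat_l; lra).
    assert (V t ^ 2 <= m) by lra.
    unfold t1 in *. lra. }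
  lra.
Qed.

(** * Coordinates of Loewner solutions *)

Lemma loewner_field_coordinates (w : C) (l : R) :
  (2 / (w - l))%C =
  (2 * (Re w - l) / ((Re w - l) ^ 2 + Im w ^ 2), - (2 * Im w) / ((Re w - l) ^ 2 + Im w ^ 2)).
Proof.
  destruct w as [x y].
  apply injective_projections; simpl; rewrite Ropp_0, Rplus_0_r; unfold Rdiv, Rminus; simpl; ring.
Qed.

Lemma loewner_solution_derive lambda z s g t :
  loewner_solution lambda z s g -> 0 < t < s ->
  is_derive (fun u => Re (g u)) t
    (2 * (Re (g t) - lambda t) / ((Re (g t) - lambda t) ^ 2 + Im (g t) ^ 2)) /\
  is_derive (fun u => Im (g u)) t
    (- (2 * Im (g t)) / ((Re (g t) - lambda t) ^ 2 + Im (g t) ^ 2)).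
Proof.
  intros [_ Hg] Ht. destruct (Hg t ltac:(lra)) as [Hnz [Hlin Hdom]].
  assert (Hfd : filterdiff (K := R_AbsRing) (V := C_R_NormedModule) g (locally t)
    (fun h : R => scal h (2 / (g t - lambda t))%C)).
  { split; [exact Hlin|]. intros x Hx eps.
    assert (Hw : is_filter_lim (within (fun u : R => 0 <= u) (locally t)) x).
    { apply (is_filter_lim_filter_le (F := locally t)); [apply filter_le_within | exact Hx]. }
    specialize (Hdom x Hw eps).
    assert (Hpos : locally t (fun u : R => 0 < u)) by (apply (open_gt 0); lra).
    unfold within in Hdom.
    eapply filter_imp; [|exact (filter_and _ _ Hdom Hpos)].
    intros u [H1 H2]. apply H1. lra. }
  split.
  - unfold is_derive.
    eapply filterdiff_ext_lin.
    + apply (filterdiff_comp (U := R_NormedModule) (V := C_R_NormedModule) (W := R_NormedModule)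
        g (fun w => fst w) _ (fun w => fst w) Hfd).
      apply filterdiff_linear, (is_linear_fst (U := R_NormedModule) (V := R_NormedModule)).
    + intros h. rewrite loewner_field_coordinates. reflexivity.
  - unfold is_derive.
    eapply filterdiff_ext_lin.
    + apply (filterdiff_comp (U := R_NormedModule) (V := C_R_NormedModule) (W := R_NormedModule)
        g (fun w => snd w) _ (fun w => snd w) Hfd).
      apply filterdiff_linear, (is_linear_snd (U := R_NormedModule) (V := R_NormedModule)).
    + intros h. rewrite loewner_field_coordinates. reflexivity.
Qed.

(** Freezing [f] before time [0] turns right continuity at [0] into two-sided
    continuity, which is what the mean value arguments above ask for. *)
Lemma continuous_extend_left (f : R -> R) :
  filterlim f (within (fun u : R => 0 <= u) (locally 0)) (locally (f 0)) ->
  continuous (fun t => f (Rmax 0 t)) 0.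
Proof.
  intros H P HP. rewrite Rmax_left in HP by lra.
  destruct (H P HP) as [d Hd].
  exists d. intros u Hu. apply Hd; [|apply Rmax_l].
  change (Rabs (u - 0) < d) in Hu. change (Rabs (Rmax 0 u - 0) < d).
  rewrite Rminus_0_r in *.
  apply Rle_lt_trans with (Rabs u); [|exact Hu].
  apply Rmax_case; [rewrite Rabs_R0; apply Rabs_pos | lra].
Qed.

Lemma loewner_solution_continuous_0 lambda z s g :
  loewner_solution lambda z s g -> 0 < s ->
  filterlim (fun u => Re (g u)) (within (fun u : R => 0 <= u) (locally 0)) (locally (Re (g 0))) /\
  filterlim (fun u => Im (g u)) (within (fun u : R => 0 <= u) (locally 0)) (locally (Im (g 0))).
Proof.
  intros [_ Hg] Hs. destruct (Hg 0 ltac:(lra)) as [_ Hfd].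
  assert (Hlim : filterlim g (within (fun u : R => 0 <= u) (locally 0))
    (locally (g 0 : C_R_NormedModule))).
  { apply (filterdiff_continuous_aux (U := R_NormedModule) (V := C_R_NormedModule) g);
      [eexists; exact Hfd|].
    intros P HP. now apply filter_le_within. }
  split.
  - apply (filterlim_comp _ _ _ g fst _ _ _ Hlim).
    intros P [d Hd]. exists d. intros w [Hw _]. now apply Hd.
  - apply (filterlim_comp _ _ _ g snd _ _ _ Hlim).
    intros P [d Hd]. exists d. intros w [_ Hw]. now apply Hd.
Qed.

Lemma is_derive_extend_left (f : R -> R) t l :
  0 < t -> is_derive f t l -> is_derive (fun u => f (Rmax 0 u)) t l.
Proof.
  intros Ht. apply is_derive_ext_loc.
  exists (mkposreal t Ht). intros u Hu. change (Rabs (u - t) < t) in Hu.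
  apply Rabs_def2 in Hu. now rewrite Rmax_right by lra.
Qed.

(** A real trajectory that is caught by the driving function at time [1]
    exactly, with a lower bound on its distance before that. *)
Record boundary_flow (r : R) (lambda P : R -> R) : Prop := {
  bf_derive : forall t, 0 <= t < 1 -> is_derive P t (2 / (P t - lambda t));
  bf_gap : forall t, 0 <= t < 1 -> 2 * rpow (1 - t) r <= lambda t - P t;
  bf_end : filterlim P (at_left 1) (locally 0)
}.

Lemma boundary_flow_gap_pos r lambda P : boundary_flow r lambda P ->
  forall t, 0 <= t < 1 -> 0 < lambda t - P t.
Proof.
  intros HP t Ht. assert (H := bf_gap _ _ _ HP t Ht).
  assert (0 < rpow (1 - t) r) by (apply rpow_gt_0; lra). lra.
Qed.

(** Passes from the complex equation to the real system for [g - P]; the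
    solution is frozen before time [0]. *)
Lemma swallowed_flow_of_solution r lambda P z s g :
  boundary_flow r lambda P -> 0 < s <= 1 ->
  loewner_solution lambda z s g ->
  filterlim (fun u : R => (g u - lambda u)%C) (at_left s) (locally (RtoC 0)) ->
  swallowed_flow r s (fun t => Re (g (Rmax 0 t)) - P t) (fun t => Im (g (Rmax 0 t)))
    (fun t => lambda t - P t).
Proof.
  intros HP Hs Hg Hlim.
  assert (Hgap : forall t, 0 <= t < s -> 0 < lambda t - P t).
  { intros t Ht. apply (boundary_flow_gap_pos _ _ _ HP); lra. }
  assert (Hnz : forall t, 0 <= t < s ->
    0 < (lambda t - P t - (Re (g t) - P t)) ^ 2 + Im (g t) ^ 2).
  { intros t Ht. destruct Hg as [_ Hg]. destruct (Hg t Ht) as [Hne _].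
    replace (lambda t - P t - (Re (g t) - P t)) with (- (Re (g t) - lambda t)) by ring.
    destruct (Req_dec (Im (g t)) 0) as [HI|HI].
    - destruct (Req_dec (Re (g t) - lambda t) 0) as [HR|HR].
      + exfalso. apply Hne. apply injective_projections; simpl; unfold Re, Im in *; lra.
      + assert (0 < (Re (g t) - lambda t) ^ 2) by (apply pow2_gt_0, HR).
        assert (0 <= Im (g t) ^ 2) by apply pow2_ge_0. nra.
    - assert (0 < Im (g t) ^ 2) by (apply pow2_gt_0, HI).
      assert (0 <= (Re (g t) - lambda t) ^ 2) by apply pow2_ge_0. nra. }
  assert (HcP : forall t, 0 <= t < s -> continuous P t).
  { intros t Ht. apply (ex_derive_continuous P). eexists. apply (bf_derive _ _ _ HP); lra. }
  constructor.
  - exact Hs.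
  - intros t Ht. apply (bf_gap _ _ _ HP). lra.
  - intros t Ht. destruct (Rle_lt_or_eq_dec 0 t) as [Ht0|Ht0]; [lra|..].
    + destruct (loewner_solution_derive _ _ _ _ t Hg ltac:(lra)) as [HR HI]. split.
      * apply (continuous_minus (fun u => Re (g (Rmax 0 u))) P); [|now apply HcP].
        apply (ex_derive_continuous (fun u => Re (g (Rmax 0 u)))). eexists.
        apply (is_derive_extend_left (fun u => Re (g u))); [exact Ht0 | exact HR].
      * apply (ex_derive_continuous (fun u => Im (g (Rmax 0 u)))). eexists.
        apply (is_derive_extend_left (fun u => Im (g u))); [exact Ht0 | exact HI].
    + subst t. destruct (loewner_solution_continuous_0 _ _ _ _ Hg) as [HR HI]; [lra|]. split.
      * apply (continuous_minus (fun u => Re (g (Rmax 0 u))) P); [|now apply HcP].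
        apply (continuous_extend_left (fun u => Re (g u)) HR).
      * apply (continuous_extend_left (fun u => Im (g u)) HI).
  - intros t Ht. destruct (loewner_solution_derive _ _ _ _ t Hg Ht) as [HR _].
    assert (HL := Hgap t ltac:(lra)). assert (HQ := Hnz t ltac:(lra)).
    rewrite Rmax_right by lra.
    evar_last.
    + apply (is_derive_minus (fun u => Re (g (Rmax 0 u))) P).
      * apply (is_derive_extend_left (fun u => Re (g u))); [lra | exact HR].
      * apply (bf_derive _ _ _ HP); lra.
    + unfold minus, plus, opp; simpl. simpl in HQ. field. repeat split; lra.
  - intros t Ht. destruct (loewner_solution_derive _ _ _ _ t Hg Ht) as [_ HI].
    assert (HQ := Hnz t ltac:(lra)).
    rewrite Rmax_right by lra.
    replace (- (2 * Im (g t) / ((lambda t - P t - (Re (g t) - P t)) ^ 2 + Im (g t) ^ 2)))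
      with (- (2 * Im (g t)) / ((Re (g t) - lambda t) ^ 2 + Im (g t) ^ 2)).
    + apply (is_derive_extend_left (fun u => Im (g u))); [lra | exact HI].
    + simpl in HQ. field. lra.
  - intros t Ht. rewrite Rmax_right by lra. now apply Hnz.
  - intros eps t0 Heps Ht0.
    assert (Hev : at_left s (fun u => ball (RtoC 0) (mkposreal eps Heps) (g u - lambda u)%C)).
    { apply Hlim, locally_ball. }
    destruct Hev as [d Hd]. assert (Hd0 := cond_pos d).
    set (m := Rmax 0 (Rmax t0 (s - d / 2))).
    assert (m < s) by (unfold m; repeat apply Rmax_lub_lt; lra).
    assert (0 <= m) by apply Rmax_l.
    assert (t0 <= m) by (eapply Rle_trans; [apply Rmax_l | apply Rmax_r]).
    assert (s - d / 2 <= m) by (eapply Rle_trans; [apply Rmax_r | apply Rmax_r]).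
    exists ((m + s) / 2). split; [lra|]. split; [lra|].
    destruct (Hd ((m + s) / 2)) as [HR HI].
    + change (Rabs ((m + s) / 2 - s) < d). apply Rabs_def1; lra.
    + lra.
    + rewrite Rmax_right by lra. simpl in HR, HI.
      change (Rabs (fst (g ((m + s) / 2)) + - lambda ((m + s) / 2) - 0) < eps) in HR.
      change (Rabs (snd (g ((m + s) / 2)) + - 0 - 0) < eps) in HI.
      unfold Re, Im. split.
      * rewrite Rabs_minus_sym. eapply Rle_lt_trans; [|exact HR]. right. f_equal. ring.
      * eapply Rle_lt_trans; [|exact HI]. right. f_equal. ring.
Qed.

(** * Construction of the boundary trajectory *)

Definition unit_clamp (u : R) : R := Rmax 0 (Rmin 1 u).

Lemma unit_clamp_range u : 0 <= unit_clamp u <= 1.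
Proof.
  unfold unit_clamp. split; [apply Rmax_l|].
  apply Rmax_lub; [lra | apply Rmin_l].
Qed.

Lemma unit_clamp_id u : 0 <= u <= 1 -> unit_clamp u = u.
Proof. intros H. unfold unit_clamp. rewrite Rmin_right, Rmax_right; lra. Qed.

Lemma unit_clamp_ge_1 u : 1 <= u -> unit_clamp u = 1.
Proof. intros H. unfold unit_clamp. rewrite Rmin_left, Rmax_right; lra. Qed.

Lemma continuous_unit_clamp u : continuous unit_clamp u.
Proof.
  apply filterlim_locally. intros eps. exists eps. intros v Hv.
  change (Rabs (v - u) < eps) in Hv. change (Rabs (unit_clamp v - unit_clamp u) < eps).
  apply Rle_lt_trans with (2 := Hv).
  unfold unit_clamp, Rmax, Rmin, Rabs.
  repeat destruct (Rle_dec _ _); repeat destruct (Rcase_abs _); lra.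
Qed.

(** Picard iteration for [Q' = 2 / (mu - Q)], [Q 0 = 0].  At step [k] the
    function [mu] is cut off below at [2^(-k)], which keeps the integrand
    continuous at [0], where [mu - Q] may vanish.  Clamping the argument confines the
    dependence on [Q] to the unit interval, while every iterate remains
    differentiable across [1]. *)
Fixpoint picard (mu : R -> R) (n : nat) : R -> R :=
  match n with
  | O => fun _ => 0
  | S k => fun x =>
      RInt (fun u => 2 / (Rmax (mu u) ((1 / 2) ^ k) - picard mu k (unit_clamp u))) 0 x
  end.

Definition picard_gap (mu : R -> R) (n : nat) (u : R) : R :=
  Rmax (mu u) ((1 / 2) ^ n) - picard mu n (unit_clamp u).

Definition picard_invariant (r : R) (f : R -> R) : Prop :=
  (forall x, continuous f x) /\
  (forall x, 0 <= x <= 1 -> 0 <= f x <= 2 * rpow x (1 - r)).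

Lemma half_pow_pos n : 0 < (1 / 2) ^ n.
Proof. apply pow_lt; lra. Qed.

(** Below the barrier [2 c^(1-r) <= 2 c^r] the gap keeps half of the lower bound
    [4 c^r]; this is where the constant [4] of the hypothesis enters. *)
Lemma gap_of_barrier (r m q c : R) :
  0 < r < 1 / 2 -> 0 <= c <= 1 -> 4 * rpow c r <= m -> q <= 2 * rpow c (1 - r) ->
  2 * rpow c r <= m - q.
Proof.
  intros Hr Hc Hm Hq.
  assert (rpow c (1 - r) <= rpow c r) by (apply rpow_exponent_le; lra). lra.
Qed.

(** At [0] the barrier vanishes together with the lower bound, and positivity
    comes from the cutoff instead. *)
Lemma picard_gap_ge r mu n u :
  0 < r < 1 / 2 -> (forall v, 4 * rpow (unit_clamp v) r <= mu v) ->
  picard_invariant r (picard mu n) ->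
  2 * rpow (unit_clamp u) r <= picard_gap mu n u /\ 0 < picard_gap mu n u.
Proof.
  intros Hr Hmu [_ Hbd]. assert (Hc := unit_clamp_range u).
  specialize (Hbd _ Hc). specialize (Hmu u).
  assert (Hge : 2 * rpow (unit_clamp u) r <= picard_gap mu n u).
  { apply gap_of_barrier; try assumption; [|lra].
    eapply Rle_trans; [exact Hmu | apply Rmax_l]. }
  split; [exact Hge|].
  destruct (Rle_lt_or_eq_dec 0 (unit_clamp u)) as [H0|H0]; [lra|..].
  - assert (0 < rpow (unit_clamp u) r) by (apply rpow_gt_0; lra). lra.
  - unfold picard_gap. rewrite <- H0 in *. rewrite rpow_nonpos in Hbd by lra.
    assert (H := Rmax_r (mu u) ((1 / 2) ^ n)). assert (H1 := half_pow_pos n). lra.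
Qed.

Lemma continuous_Rmax_const (f : R -> R) (k x : R) :
  continuous f x -> continuous (fun u => Rmax (f u) k) x.
Proof.
  intros H. apply (continuous_comp f (fun v => Rmax v k)); [exact H|].
  apply filterlim_locally. intros eps. exists eps. intros v Hv.
  change (Rabs (v - f x) < eps) in Hv. change (Rabs (Rmax v k - Rmax (f x) k) < eps).
  apply Rle_lt_trans with (2 := Hv). unfold Rmax, Rabs.
  repeat destruct (Rle_dec _ _); repeat destruct (Rcase_abs _); lra.
Qed.

Lemma continuous_two_div (f : R -> R) x :
  continuous f x -> f x <> 0 -> continuous (fun u => 2 / f u) x.
Proof.
  intros Hf H0. apply (continuous_mult (fun _ => 2) (fun u => / f u)).
  - apply continuous_const.
  - apply (continuous_comp f Rinv); [exact Hf|].
    apply continuity_pt_filterlim, continuity_pt_inv; [|exact H0].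
    apply derivable_continuous_pt, derivable_pt_id.
Qed.

Lemma continuous_picard_integrand r mu n x :
  0 < r < 1 / 2 -> (forall v, continuous mu v) ->
  (forall v, 4 * rpow (unit_clamp v) r <= mu v) ->
  picard_invariant r (picard mu n) ->
  continuous (fun u => 2 / picard_gap mu n u) x.
Proof.
  intros Hr Hc Hmu Hinv. apply continuous_two_div.
  - apply (continuous_minus (fun u => Rmax (mu u) ((1 / 2) ^ n))
      (fun u => picard mu n (unit_clamp u))).
    + now apply continuous_Rmax_const.
    + apply (continuous_comp unit_clamp); [apply continuous_unit_clamp | apply Hinv].
  - assert (H := picard_gap_ge r mu n x Hr Hmu Hinv). lra.
Qed.

Lemma is_derive_picard r mu n x :
  0 < r < 1 / 2 -> (forall v, continuous mu v) ->
  (forall v, 4 * rpow (unit_clamp v) r <= mu v) ->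
  picard_invariant r (picard mu n) ->
  is_derive (picard mu (S n)) x (2 / picard_gap mu n x).
Proof.
  intros Hr Hc Hmu Hinv.
  assert (Hcont := fun v => continuous_picard_integrand r mu n v Hr Hc Hmu Hinv).
  apply (is_derive_RInt (fun u => 2 / picard_gap mu n u) (picard mu (S n)) 0 x);
    [|apply Hcont].
  apply filter_forall. intros b. apply (RInt_correct (fun u => 2 / picard_gap mu n u)).
  apply (ex_RInt_continuous (fun u => 2 / picard_gap mu n u)).
  intros z _. apply Hcont.
Qed.

Lemma picard_0 mu n : picard mu n 0 = 0.
Proof. destruct n; [reflexivity | exact (RInt_point 0 _)]. Qed.

(** The barrier is preserved since [2 / gap <= x^(-r) <= 2 (1 - r) x^(-r)], the
    right side being the slope of [2 x^(1-r)]; here [r <= 1/2] is used. *)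
Lemma picard_invariant_all r mu n :
  0 < r < 1 / 2 -> (forall v, continuous mu v) ->
  (forall v, 4 * rpow (unit_clamp v) r <= mu v) ->
  picard_invariant r (picard mu n).
Proof.
  intros Hr Hc Hmu. induction n as [|n IH].
  - split.
    + intros x. apply continuous_const.
    + intros x Hx. simpl. assert (0 <= rpow x (1 - r)) by apply rpow_ge_0. lra.
  - assert (Hd := fun x => is_derive_picard r mu n x Hr Hc Hmu IH).
    assert (Hg := fun x => picard_gap_ge r mu n x Hr Hmu IH).
    assert (Hcont : forall x, continuous (picard mu (S n)) x).
    { intros x. apply (ex_derive_continuous (picard mu (S n))). eexists. apply Hd. }
    split; [exact Hcont|].
    intros x Hx. split.
    + rewrite <- (picard_0 mu (S n)) at 1.
      apply le_of_derive_nonneg with (df := fun u => 2 / picard_gap mu n u);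
        [lra | intros; apply Hd | intros; apply Hcont |].
      intros u Hu. apply Rdiv_le_0_compat; [lra | apply Hg].
    + assert (H : 2 * rpow 0 (1 - r) - picard mu (S n) 0
        <= 2 * rpow x (1 - r) - picard mu (S n) x);
        [|rewrite picard_0, (rpow_nonpos 0) in H by lra; lra].
      apply le_of_derive_nonneg with
        (f := fun u => 2 * rpow u (1 - r) - picard mu (S n) u)
        (df := fun u => 2 * ((1 - r) * rpow u (1 - r - 1)) - 2 / picard_gap mu n u); [lra|..].
      * intros u Hu. apply (is_derive_minus (fun u => 2 * rpow u (1 - r))); [|apply Hd].
        apply is_derive_scal, is_derive_rpow; lra.
      * intros u Hu. apply (continuous_minus (fun u => 2 * rpow u (1 - r))); [|apply Hcont].
        apply (continuous_mult (fun _ => 2) (fun v => rpow v (1 - r)));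
          [apply continuous_const | apply continuous_rpow; lra].
      * intros u Hu. destruct (Hg u) as [Hge Hpos]. rewrite unit_clamp_id in Hge by lra.
        assert (H0 : 0 < rpow u r) by (apply rpow_gt_0; lra).
        assert (H1 : rpow u (1 - r - 1) * rpow u r = 1).
        { rewrite <- rpow_plus by lra. replace (1 - r - 1 + r) with 0 by ring.
          rewrite rpow_pos by lra. apply Rpower_O; lra. }
        assert (H2 : 2 / picard_gap mu n u <= rpow u (1 - r - 1)).
        { apply Rle_div_l; [exact Hpos|].
          assert (0 < rpow u (1 - r - 1)) by (apply rpow_gt_0; lra). nra. }
        assert (0 < rpow u (1 - r - 1)) by (apply rpow_gt_0; lra). nra.
Qed.

(** The Lipschitz constant of the Loewner field at distance [2 c^r] from its
    pole. *)
Lemma two_div_lipschitz (r c g1 g2 : R) :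
  0 < c -> 2 * rpow c r <= g1 -> 2 * rpow c r <= g2 ->
  Rabs (2 / g1 - 2 / g2) <= 1 / 2 * rpow c (- (2 * r)) * Rabs (g1 - g2).
Proof.
  intros Hc H1 H2.
  assert (Hp : 0 < rpow c r) by (apply rpow_gt_0; lra).
  assert (He : rpow c (- (2 * r)) = / (rpow c r * rpow c r)).
  { assert (rpow c r * rpow c r <> 0) by (apply Rmult_integral_contrapositive; lra).
    apply Rmult_eq_reg_r with (rpow c r * rpow c r); [|assumption].
    rewrite rpow_neg_double, Rinv_l by assumption. reflexivity. }
  assert (Hg : 0 < g1 * g2) by (apply Rmult_lt_0_compat; lra).
  replace (2 / g1 - 2 / g2) with (- (2 * (g1 - g2) / (g1 * g2))) by (field; lra).
  rewrite Rabs_Ropp. unfold Rdiv. rewrite !Rabs_mult, Rabs_inv.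
  rewrite (Rabs_pos_eq 2), (Rabs_pos_eq (g1 * g2)) by lra.
  assert (Hi : / (g1 * g2) <= / 4 * / (rpow c r * rpow c r)).
  { rewrite <- Rinv_mult. apply Rinv_le_contravar; nra. }
  rewrite He. assert (0 <= Rabs (g1 - g2)) by apply Rabs_pos. nra.
Qed.

(** The term [x^(1-2r)] absorbs the singular Lipschitz constant near [0].  The
    linear term serves beyond [1], where the clamped equation has constant
    right-hand side but [x^(-2r)] decays. *)
Definition picard_majorant (r x : R) : R :=
  exp (2 / (1 - 2 * r) * (rpow x (1 - 2 * r) + x)).

Lemma picard_majorant_pos r x : 0 < picard_majorant r x.
Proof. apply exp_pos. Qed.

Lemma picard_majorant_ge_1 r x :
  0 < r < 1 / 2 -> 0 <= x -> 1 <= picard_majorant r x.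
Proof.
  intros Hr Hx. apply Rle_trans with (exp 0); [rewrite exp_0; lra|].
  apply exp_le. apply Rmult_le_pos.
  - apply Rdiv_le_0_compat; lra.
  - assert (0 <= rpow x (1 - 2 * r)) by apply rpow_ge_0. lra.
Qed.

Lemma picard_majorant_le r x y :
  0 < r < 1 / 2 -> x <= y -> picard_majorant r x <= picard_majorant r y.
Proof.
  intros Hr Hxy. apply exp_le. apply Rmult_le_compat_l.
  - apply Rdiv_le_0_compat; lra.
  - apply Rplus_le_compat; [apply rpow_base_le; lra | exact Hxy].
Qed.

Lemma is_derive_picard_majorant r x :
  0 < r < 1 / 2 -> 0 < x ->
  is_derive (picard_majorant r) x
    ((2 * rpow x (- (2 * r)) + 2 / (1 - 2 * r)) * picard_majorant r x).
Proof.
  intros Hr Hx. unfold picard_majorant at 1. evar_last.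
  - apply (is_derive_comp exp (fun u => 2 / (1 - 2 * r) * (rpow u (1 - 2 * r) + u))).
    + apply is_derive_exp.
    + apply is_derive_scal.
      apply (is_derive_plus (fun u => rpow u (1 - 2 * r)) (fun u => u)).
      * now apply is_derive_rpow.
      * apply (is_derive_id (K := R_AbsRing)).
  - unfold scal, plus, one; simpl. unfold mult; simpl. unfold picard_majorant.
    replace (1 - 2 * r - 1) with (- (2 * r)) by ring. field. lra.
Qed.

Lemma continuous_picard_majorant r x :
  0 < r < 1 / 2 -> continuous (picard_majorant r) x.
Proof.
  intros Hr. apply (continuous_comp
    (fun u => 2 / (1 - 2 * r) * (rpow u (1 - 2 * r) + u)) exp); [|apply continuous_exp].
  apply (continuous_mult (fun _ => 2 / (1 - 2 * r)) (fun u => rpow u (1 - 2 * r) + u)).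
  - apply continuous_const.
  - apply (continuous_plus (fun u => rpow u (1 - 2 * r)) (fun u : R => u)).
    + apply continuous_rpow; lra.
    + apply continuous_id.
Qed.

Lemma Rmax_half_pow_diff m n :
  Rabs (Rmax m ((1 / 2) ^ S n) - Rmax m ((1 / 2) ^ n)) <= (1 / 2) ^ n.
Proof.
  assert (H := half_pow_pos n). simpl. set (e := (1 / 2) ^ n) in *.
  unfold Rmax, Rabs. repeat destruct (Rle_dec _ _); repeat destruct (Rcase_abs _); lra.
Qed.

(** The gaps of two consecutive iterates differ by at most [2^(-n)] from the
    cutoffs plus [2 2^(-n)] times the majorant, hence by [3 2^(-n)] times the
    majorant.  The Lipschitz constant [x^(-2r) / 2] turns this into [3/2], while
    the majorant of the next step grows with the factor [2]. *)
Lemma picard_increment r mu :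
  0 < r < 1 / 2 -> (forall v, continuous mu v) ->
  (forall v, 4 * rpow (unit_clamp v) r <= mu v) ->
  forall n x, 0 <= x ->
  Rabs (picard mu (S n) x - picard mu n x) <= 2 * (1 / 2) ^ n * picard_majorant r x.
Proof.
  intros Hr Hc Hmu.
  assert (Hinv := fun n => picard_invariant_all r mu n Hr Hc Hmu).
  assert (Hd := fun n x => is_derive_picard r mu n x Hr Hc Hmu (Hinv n)).
  assert (Hg := fun n x => picard_gap_ge r mu n x Hr Hmu (Hinv n)).
  assert (HE := picard_majorant_pos r).
  assert (Hk : 2 <= 2 / (1 - 2 * r)) by (apply Rle_div_r; lra).
  induction n as [|n IH]; intros x Hx.
  - (* the first iterate grows at most linearly beyond [1], like the majorant *)
    simpl pow. rewrite Rmult_1_r.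
    assert (Hder : forall u, 0 < u ->
      2 / picard_gap mu 0 u <= rpow u (- (2 * r)) + 1).
    { intros u Hu. destruct (Hg 0%nat u) as [Hge Hpos].
      assert (Hcl := unit_clamp_range u).
      apply Rle_div_l; [exact Hpos|].
      destruct (Rle_lt_dec u 1) as [Hu1|Hu1].
      - rewrite unit_clamp_id in Hge by lra.
        assert (H2 := rpow_neg_double u r Hu).
        assert (Hp : 0 < rpow u r <= 1).
        { split; [apply rpow_gt_0; lra | apply rpow_le_1; lra]. }
        assert (0 < rpow u (- (2 * r))) by (apply rpow_gt_0; lra). nra.
      - rewrite unit_clamp_ge_1, rpow_1 in Hge by lra.
        assert (0 <= rpow u (- (2 * r))) by apply rpow_ge_0. nra. }
    assert (H0 : picard mu 0 x = 0) by reflexivity. rewrite H0, Rminus_0_r.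
    rewrite Rabs_pos_eq.
    + assert (H : 2 * picard_majorant r 0 - picard mu 1 0
        <= 2 * picard_majorant r x - picard mu 1 x).
      { apply le_of_derive_nonneg with
          (f := fun u => 2 * picard_majorant r u - picard mu 1 u)
          (df := fun u => 2 * ((2 * rpow u (- (2 * r)) + 2 / (1 - 2 * r))
             * picard_majorant r u) - 2 / picard_gap mu 0 u); [lra|..].
        - intros u Hu. apply (is_derive_minus (fun u => 2 * picard_majorant r u)); [|apply Hd].
          apply is_derive_scal, is_derive_picard_majorant; lra.
        - intros u Hu. apply (continuous_minus (fun u => 2 * picard_majorant r u));
            [|apply Hinv].
          apply (continuous_mult (fun _ => 2) (picard_majorant r));
            [apply continuous_const | now apply continuous_picard_majorant].
        - intros u Hu. specialize (Hder u ltac:(lra)).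
          assert (1 <= picard_majorant r u).
          { apply picard_majorant_ge_1; lra. }
          assert (0 <= rpow u (- (2 * r))) by apply rpow_ge_0. nra. }
      rewrite picard_0 in H. specialize (HE 0). lra.
    + rewrite <- (picard_0 mu 1) at 1.
      apply le_of_derive_nonneg with (df := fun u => 2 / picard_gap mu 0 u);
        [lra | intros; apply Hd | intros; apply Hinv |].
      intros u Hu. apply Rdiv_le_0_compat; [lra | apply Hg].
  - assert (Hder : forall u, 0 < u ->
      Rabs (2 / picard_gap mu (S n) u - 2 / picard_gap mu n u)
        <= 2 * (1 / 2) ^ S n * ((2 * rpow u (- (2 * r)) + 2 / (1 - 2 * r)) * picard_majorant r u)).
    { intros u Hu. assert (Hcl := unit_clamp_range u).
      assert (Hcu : 0 < unit_clamp u <= u).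
      { destruct (Rle_lt_dec u 1); [rewrite unit_clamp_id | rewrite unit_clamp_ge_1]; lra. }
      assert (He := half_pow_pos n).
      assert (HEc := picard_majorant_le r _ _ Hr (proj2 Hcu)).
      assert (HE1 : 1 <= picard_majorant r (unit_clamp u)).
      { apply picard_majorant_ge_1; lra. }
      assert (Hgap : Rabs (picard_gap mu (S n) u - picard_gap mu n u)
        <= 3 * (1 / 2) ^ n * picard_majorant r u).
      { specialize (IH (unit_clamp u) ltac:(lra)).
        assert (Hm := Rmax_half_pow_diff (mu u) n).
        unfold picard_gap.
        replace (Rmax (mu u) ((1 / 2) ^ S n) - picard mu (S n) (unit_clamp u) -
          (Rmax (mu u) ((1 / 2) ^ n) - picard mu n (unit_clamp u)))
          with ((Rmax (mu u) ((1 / 2) ^ S n) - Rmax (mu u) ((1 / 2) ^ n)) +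
            - (picard mu (S n) (unit_clamp u) - picard mu n (unit_clamp u))) by ring.
        eapply Rle_trans; [apply Rabs_triang|]. rewrite Rabs_Ropp. nra. }
      assert (Hw : rpow (unit_clamp u) (- (2 * r)) <= rpow u (- (2 * r)) + 1).
      { destruct (Rle_lt_dec u 1) as [Hu1|Hu1].
        - rewrite unit_clamp_id; lra.
        - rewrite unit_clamp_ge_1, rpow_1 by lra.
          assert (0 <= rpow u (- (2 * r))) by apply rpow_ge_0. lra. }
      assert (Hw0 : 0 <= rpow (unit_clamp u) (- (2 * r))) by apply rpow_ge_0.
      eapply Rle_trans.
      { apply (two_div_lipschitz r (unit_clamp u)); [lra | apply Hg | apply Hg]. }
      assert (HEu := HE u).
      apply Rle_trans with
        (1 / 2 * (rpow u (- (2 * r)) + 1) * (3 * (1 / 2) ^ n * picard_majorant r u)).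
      - apply Rmult_le_compat; [lra | apply Rabs_pos | lra | exact Hgap].
      - simpl. assert (0 < (1 / 2) ^ n * picard_majorant r u) by (apply Rmult_lt_0_compat; lra).
        assert (0 <= rpow u (- (2 * r))) by apply rpow_ge_0. nra. }
    (* monotonicity arguments bound one side only, so they are run for both signs *)
    assert (Hside : forall sg, sg = 1 \/ sg = -1 ->
      sg * (picard mu (S (S n)) x - picard mu (S n) x)
        <= 2 * (1 / 2) ^ S n * picard_majorant r x).
    { intros sg Hsg.
      set (e := 2 * (1 / 2) ^ S n).
      assert (Hepos : 0 < e) by (assert (H := half_pow_pos (S n)); unfold e; lra).
      assert (H : e * picard_majorant r 0 - sg * (picard mu (S (S n)) 0 - picard mu (S n) 0)
        <= e * picard_majorant r x - sg * (picard mu (S (S n)) x - picard mu (S n) x)).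
      { apply le_of_derive_nonneg with
          (f := fun u => e * picard_majorant r u - sg * (picard mu (S (S n)) u - picard mu (S n) u))
          (df := fun u => e * ((2 * rpow u (- (2 * r)) + 2 / (1 - 2 * r))
             * picard_majorant r u)
             - sg * (2 / picard_gap mu (S n) u - 2 / picard_gap mu n u)); [lra|..].
        - intros u Hu. apply (is_derive_minus (fun u => e * picard_majorant r u)).
          + apply is_derive_scal, is_derive_picard_majorant; lra.
          + apply is_derive_scal.
            apply (is_derive_minus (picard mu (S (S n))) (picard mu (S n))); apply Hd.
        - intros u Hu. apply (continuous_minus (fun u => e * picard_majorant r u)).
          + apply (continuous_mult (fun _ => e) (picard_majorant r));
              [apply continuous_const | now apply continuous_picard_majorant].
          + apply (continuous_mult (fun _ => sg)); [apply continuous_const|].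
            apply (continuous_minus (picard mu (S (S n))) (picard mu (S n))); apply Hinv.
        - intros u Hu. specialize (Hder u ltac:(lra)). fold e in Hder.
          apply Rabs_le_between in Hder. destruct Hsg; subst sg; lra. }
      rewrite !picard_0 in H. assert (0 < e * picard_majorant r 0) by (apply Rmult_lt_0_compat; auto).
      lra. }
    apply Rabs_le. assert (Ha := Hside 1 ltac:(auto)). assert (Hb := Hside (-1) ltac:(auto)). lra.
Qed.

(** The lower envelopes [f n - 2 2^(-n) B] increase, the upper ones decrease,
    and each lower one is below each upper one; the limit is the supremum of the
    former. *)
Lemma geometric_increments_converge (D : R -> Prop) (f : nat -> R -> R) (B : R -> R) :
  (forall n x, D x -> Rabs (f (S n) x - f n x) <= (1 / 2) ^ n * B x) ->
  exists g : R -> R, forall n x, D x -> Rabs (f n x - g x) <= 2 * (1 / 2) ^ n * B x.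
Proof.
  intros Hf.
  set (lo := fun x y => exists n, y = f n x - 2 * (1 / 2) ^ n * B x).
  exists (fun x => real (Lub_Rbar (lo x))). intros n x Hx.
  set (v := fun n => f n x - 2 * (1 / 2) ^ n * B x).
  set (w := fun n => f n x + 2 * (1 / 2) ^ n * B x).
  assert (Hstep : forall k, v k <= v (S k) /\ w (S k) <= w k /\ v k <= w k).
  { intros k. assert (H := Hf k x Hx). assert (H0 := Rabs_pos (f (S k) x - f k x)).
    apply Rabs_le_between in H. unfold v, w. simpl pow. lra. }
  assert (Hv : forall j k, v k <= v (k + j)%nat /\ w (k + j)%nat <= w k).
  { induction j as [|j IH]; intros k.
    - rewrite Nat.add_0_r. lra.
    - rewrite Nat.add_succ_r. specialize (IH k). specialize (Hstep (k + j)%nat). lra. }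
  assert (Hvw : forall j k, v j <= w k).
  { intros j k. destruct (Hv k j) as [H1 _]. destruct (Hv j k) as [_ H2].
    rewrite (Nat.add_comm k j) in H2. destruct (Hstep (j + k)%nat) as [_ [_ H3]]. lra. }
  destruct (Lub_Rbar_correct (lo x)) as [Hub Hlub].
  destruct (Lub_Rbar (lo x)) as [l| |].
  - simpl. assert (H1 : v n <= l) by (apply (Hub (v n)); now exists n).
    assert (H2 : l <= w n).
    { apply (Hlub (w n)). intros y [k Hk]. subst y. apply (Hvw k n). }
    unfold v, w in *. apply Rabs_le. lra.
  - exfalso. apply (Hlub (w n)). intros y [k Hk]. subst y. apply (Hvw k n).
  - exfalso. apply (Hub (v n)). now exists n.
Qed.

Lemma half_pow_small (K eps : R) : 0 < K -> 0 < eps ->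
  exists N, forall n, (N <= n)%nat -> K * (1 / 2) ^ n < eps.
Proof.
  intros HK Heps.
  destruct (pow_lt_1_zero (1 / 2)) with (y := eps / K) as [N HN].
  - rewrite Rabs_pos_eq; lra.
  - apply Rdiv_lt_0_compat; lra.
  - exists N. intros n Hn. specialize (HN n Hn).
    rewrite Rabs_pos_eq in HN by apply Rlt_le, half_pow_pos.
    apply Rlt_div_r in HN; lra.
Qed.

Lemma le_of_half_pow (x c K : R) : (forall n, x <= c + K * (1 / 2) ^ n) -> x <= c.
Proof.
  intros H. destruct (Rle_lt_dec x c) as [Hle|Hlt]; [exact Hle | exfalso].
  destruct (Rle_lt_dec K 0) as [HK|HK].
  - specialize (H 0%nat). simpl in H. lra.
  - destruct (half_pow_small K (x - c)) as [N HN]; [lra | lra |].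
    specialize (HN N (Nat.le_refl N)). specialize (H N). lra.
Qed.

Lemma continuous_on_clamp_time (lambda : R -> R) u :
  continuous_on (fun t : R => 0 <= t <= 1) lambda ->
  continuous (fun v => lambda (1 - unit_clamp v)) u.
Proof.
  intros Hc P HP. assert (Hu := unit_clamp_range u).
  assert (H := Hc (1 - unit_clamp u) ltac:(lra) P HP).
  assert (Hk : continuous (fun v => 1 - unit_clamp v) u).
  { apply (continuous_minus (fun _ => 1) unit_clamp);
      [apply continuous_const | apply continuous_unit_clamp]. }
  specialize (Hk _ H). unfold filtermap in *.
  eapply filter_imp; [|exact Hk]. intros v Hv. apply Hv.
  assert (Hcv := unit_clamp_range v). lra.
Qed.

(** [P t] is the limit of the Picard iterates at [1 - t].  Away from [0] their
    gaps are bounded below, so the derivatives converge locally uniformly and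
    the limit solves the equation; the barrier gives the gap and [P 1 = 0]. *)
Lemma exists_boundary_flow a r lambda :
  4 <= a -> 0 < r < 1 / 2 ->
  continuous_on (fun t : R => 0 <= t <= 1) lambda ->
  (forall t : R, 0 <= t <= 1 -> a * rpow (1 - t) r <= lambda t) ->
  exists P, boundary_flow r lambda P.
Proof.
  intros Ha Hr Hlc Hlam.
  set (mu := fun v => lambda (1 - unit_clamp v)).
  assert (Hc : forall v, continuous mu v) by (intros; now apply continuous_on_clamp_time).
  assert (Hmu : forall v, 4 * rpow (unit_clamp v) r <= mu v).
  { intros v. assert (Hv := unit_clamp_range v).
    specialize (Hlam (1 - unit_clamp v) ltac:(lra)).
    replace (1 - (1 - unit_clamp v)) with (unit_clamp v) in Hlam by ring.
    assert (0 <= rpow (unit_clamp v) r) by apply rpow_ge_0.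
    apply Rle_trans with (2 := Hlam). nra. }
  assert (Hinv := fun n => picard_invariant_all r mu n Hr Hc Hmu).
  assert (Hgap := fun n x => picard_gap_ge r mu n x Hr Hmu (Hinv n)).
  destruct (geometric_increments_converge (fun x => 0 <= x) (picard mu)
    (fun x => 2 * picard_majorant r x)) as [Q HQ].
  { intros n x Hx. assert (H := picard_increment r mu Hr Hc Hmu n x Hx). lra. }
  assert (HQb : forall x, 0 <= x <= 1 -> 0 <= Q x <= 2 * rpow x (1 - r)).
  { intros x Hx.
    assert (Hn : forall n, Rabs (picard mu n x - Q x) <= 4 * picard_majorant r x * (1 / 2) ^ n).
    { intros n. specialize (HQ n x ltac:(lra)). lra. }
    split; apply le_of_half_pow with (K := 4 * picard_majorant r x); intros n;
      specialize (Hn n); apply Rabs_le_between in Hn;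
      assert (H := proj2 (Hinv n) x Hx); lra. }
  assert (HQgap : forall x, 2 * rpow (unit_clamp x) r <= mu x - Q (unit_clamp x)).
  { intros x. assert (Hx := unit_clamp_range x).
    apply gap_of_barrier; [exact Hr | exact Hx | apply Hmu | now apply HQb]. }
  assert (HQd : forall x, 0 < x -> is_derive Q x (2 / (mu x - Q (unit_clamp x)))).
  { intros x Hx. apply is_derive_Reals.
    assert (Hx2 : 0 < x / 2) by lra.
    apply (CVU_derivable (fun n => picard mu (S n)) (fun n y => 2 / picard_gap mu n y)
      Q (fun y => 2 / (mu y - Q (unit_clamp y))) x (mkposreal _ Hx2)).
    (* on the ball of radius [x / 2] all gaps are at least [2 c^r] *)
    - set (c := unit_clamp (x / 2)).
      assert (Hc0 : 0 < c).
      { unfold c. destruct (Rle_lt_dec (x / 2) 1);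
          [rewrite unit_clamp_id | rewrite unit_clamp_ge_1]; lra. }
      set (K := 1 / 2 * rpow c (- (2 * r)) * (1 + 4 * picard_majorant r 1)).
      assert (HK : 0 < K).
      { assert (0 < rpow c (- (2 * r))) by now apply rpow_gt_0.
        assert (Hmaj := picard_majorant_pos r 1). unfold K. nra. }
      intros eps Heps.
      destruct (half_pow_small K eps HK Heps) as [N HN].
      exists N. intros n y Hn Hy. specialize (HN n Hn).
      apply Rle_lt_trans with (2 := HN).
      unfold Boule in Hy. simpl in Hy. apply Rabs_def2 in Hy.
      assert (Hcy : rpow c r <= rpow (unit_clamp y) r).
      { apply rpow_base_le; [lra|]. unfold c, unit_clamp.
        apply Rle_max_compat_l, Rle_min_compat_l. lra. }
      assert (Hy01 := unit_clamp_range y).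
      eapply Rle_trans.
      { apply (two_div_lipschitz r c); [exact Hc0 | |].
        - specialize (HQgap y). lra.
        - destruct (Hgap n y). lra. }
      replace (K * (1 / 2) ^ n)
        with (1 / 2 * rpow c (- (2 * r)) * ((1 + 4 * picard_majorant r 1) * (1 / 2) ^ n))
        by (unfold K; ring).
      apply Rmult_le_compat_l.
      + assert (0 < rpow c (- (2 * r))) by now apply rpow_gt_0. lra.
      + assert (H1 := HQ n (unit_clamp y) ltac:(lra)).
        assert (H2 := picard_majorant_le r (unit_clamp y) 1 Hr ltac:(lra)).
        assert (H3 := half_pow_pos n).
        assert (H4 : 0 <= mu y).
        { apply Rle_trans with (2 := Hmu y).
          assert (0 <= rpow (unit_clamp y) r) by apply rpow_ge_0. lra. }
        assert (H5 : Rabs (mu y - Rmax (mu y) ((1 / 2) ^ n)) <= (1 / 2) ^ n).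
        { unfold Rmax, Rabs. destruct (Rle_dec _ _); destruct (Rcase_abs _); lra. }
        unfold picard_gap.
        replace (mu y - Q (unit_clamp y) -
          (Rmax (mu y) ((1 / 2) ^ n) - picard mu n (unit_clamp y)))
          with ((mu y - Rmax (mu y) ((1 / 2) ^ n)) +
            (picard mu n (unit_clamp y) - Q (unit_clamp y))) by ring.
        eapply Rle_trans; [apply Rabs_triang|]. nra.
    - intros y Hy. unfold Boule in Hy. simpl in Hy. apply Rabs_def2 in Hy.
      assert (Hy0 : 0 <= y) by lra.
      set (K := 4 * picard_majorant r y).
      assert (HK : 0 < K) by (assert (H := picard_majorant_pos r y); unfold K; lra).
      intros eps Heps.
      destruct (half_pow_small K eps HK Heps) as [N HN].
      exists N. intros n Hn. specialize (HN (S n) ltac:(apply Nat.le_trans with n; auto)).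
      apply Rle_lt_trans with (2 := HN). unfold R_dist.
      specialize (HQ (S n) y Hy0). unfold K. lra.
    - intros n y _. apply is_derive_Reals. now apply (is_derive_picard r).
    - unfold Boule. simpl. rewrite Rminus_diag, Rabs_R0. lra. }
  exists (fun t => Q (1 - t)).
  constructor.
  - intros t Ht. specialize (HQd (1 - t) ltac:(lra)).
    evar_last.
    + apply (is_derive_comp Q (fun u => 1 - u)); [exact HQd|].
      instantiate (1 := -1). auto_derive; [exact I | ring].
    + specialize (HQgap (1 - t)). rewrite unit_clamp_id in * by lra.
      assert (0 < rpow (1 - t) r) by (apply rpow_gt_0; lra).
      unfold mu in *. rewrite unit_clamp_id in * by lra.
      replace (1 - (1 - t)) with t in * by ring.
      unfold scal; simpl. unfold mult; simpl. field. lra.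
  - intros t Ht. specialize (HQgap (1 - t)). unfold mu in HQgap.
    rewrite unit_clamp_id in HQgap by lra.
    replace (1 - (1 - t)) with t in HQgap by ring. exact HQgap.
  - apply filterlim_locally. intros eps.
    assert (H := continuous_rpow 0 (1 - r) ltac:(lra)).
    destruct (proj1 (filterlim_locally _ _) H (pos_div_2 eps)) as [d Hd].
    assert (Hd0 := cond_pos d).
    exists (mkposreal (Rmin d 1) (Rmin_pos _ _ Hd0 Rlt_0_1)). intros t Ht Ht1.
    change (Rabs (t - 1) < Rmin d 1) in Ht.
    assert (Hm1 := Rmin_l d 1). assert (Hm2 := Rmin_r d 1). apply Rabs_def2 in Ht.
    assert (Hball : Rabs (rpow (1 - t) (1 - r) - rpow 0 (1 - r)) < eps / 2).
    { apply Hd. change (Rabs (1 - t - 0) < d). apply Rabs_def1; lra. }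
    rewrite (rpow_nonpos 0), Rminus_0_r in Hball by lra. apply Rabs_def2 in Hball.
    change (Rabs (Q (1 - t) - 0) < eps).
    specialize (HQb (1 - t) ltac:(lra)). apply Rabs_def1; lra.
Qed.

(** * The leftmost point of the hull *)

Lemma proper_filter_right (t : R) :
  0 <= t -> ProperFilter (within (fun u : R => 0 <= u) (locally t)).
Proof.
  intros Ht. constructor; [|apply within_filter, locally_filter].
  intros P HP. exists t. unfold within in HP.
  exact (locally_singleton t _ HP Ht).
Qed.

Lemma is_linear_RtoC : is_linear (U := R_NormedModule) (V := C_R_NormedModule) RtoC.
Proof.
  apply (is_linear_prod (T := R_NormedModule) (U := R_NormedModule) (V := R_NormedModule)
    (fun x => x) (fun _ => 0)); [apply is_linear_id | exact (is_linear_zero (U := R_NormedModule) (V := R_NormedModule))].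
Qed.

Lemma boundary_flow_in_hull r (lambda P : R -> R) :
  continuous_on (fun t : R => 0 <= t <= 1) lambda -> lambda 1 = 0 ->
  boundary_flow r lambda P -> loewner_hull lambda 1 (RtoC (P 0)).
Proof.
  intros Hc H1 HP. split; [simpl; lra|]. right.
  exists 1, (fun t => RtoC (P t)). split; [lra|]. split; [split; [reflexivity|]|].
  - intros t Ht. assert (Hg := boundary_flow_gap_pos _ _ _ HP t Ht). split.
    + intros He. apply (f_equal fst) in He. simpl in He. lra.
    + assert (Hpf := proper_filter_right t ltac:(lra)).
      apply filterdiff_locally with t; [intros A HA; now apply filter_le_within|].
      eapply filterdiff_ext_lin.
      * apply (filterdiff_comp (U := R_NormedModule) (V := R_NormedModule)
          (W := C_R_NormedModule) P RtoC _ RtoC (bf_derive _ _ _ HP t Ht)).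
        apply filterdiff_linear, is_linear_RtoC.
      * intros h. rewrite loewner_field_coordinates. simpl.
        apply injective_projections; unfold scal; simpl; unfold mult; simpl;
          match goal with |- ?l = scal h ?y => change (@eq R l (h * y)) end; field; try nra.
  - apply (filterlim_locally (U := C_UniformSpace)). intros eps.
    assert (Hl : at_left 1 (fun t => Rabs (lambda t) < eps / 2)).
    { assert (H : within (fun t : R => 0 <= t <= 1) (locally 1) (fun t => Rabs (lambda t) < eps / 2)).
      { apply (Hc 1 ltac:(lra) (fun y => Rabs y < eps / 2)).
        exists (pos_div_2 eps). intros y Hy. rewrite H1 in Hy.
        change (Rabs (y - 0) < eps / 2) in Hy. now rewrite Rminus_0_r in Hy. }
      assert (Hpos : locally 1 (fun t : R => 0 < t)) by (apply (open_gt 0); lra).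
      unfold at_left, within in *.
      eapply filter_imp; [|exact (filter_and _ _ H Hpos)].
      intros t [Ha Hb] Ht. apply Ha. lra. }
    assert (Hp := proj1 (filterlim_locally _ _) (bf_end _ _ _ HP) (pos_div_2 eps)).
    eapply filter_imp; [|exact (filter_and _ _ Hl Hp)].
    intros t [Ha Hb]. change (Rabs (P t - 0) < eps / 2) in Hb.
    rewrite Rminus_0_r in Hb.
    split.
    + change (Rabs (P t + - lambda t - 0) < eps).
      apply Rabs_def2 in Ha. apply Rabs_def2 in Hb. apply Rabs_def1; lra.
    + change (Rabs (0 + - 0 - 0) < eps).
      replace (0 + - 0 - 0) with 0 by ring. rewrite Rabs_R0. apply cond_pos.
Qed.

Lemma hull_not_left_of_boundary_flow r lambda P z :
  0 < r < 1 / 2 -> boundary_flow r lambda P -> loewner_hull lambda 1 z ->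
  Re z < P 0 -> Im z < (P 0 - Re z) * exp (- (1 / (1 - 2 * r))) -> False.
Proof.
  intros Hr HP [Him [Hz | [s [g [Hs [Hg Hlim]]]]]] Hre Hsmall.
  - subst z. simpl in Hre. assert (H := boundary_flow_gap_pos _ _ _ HP 0 ltac:(lra)). lra.
  - assert (HF := swallowed_flow_of_solution r lambda P z s g HP Hs Hg Hlim).
    destruct Hg as [H0 _].
    apply (not_swallowed_on_the_left _ _ _ _ _ Hr HF); simpl; rewrite Rmax_left, H0 by lra.
    + lra.
    + exact Him.
    + replace (- (Re z - P 0)) with (P 0 - Re z) by ring. exact Hsmall.
Qed.

(** A real point has no imaginary part, so the smallness condition on it is
    void and every real point left of [P 0] escapes. *)
Lemma hull_glb r lambda P :
  0 < r < 1 / 2 ->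
  continuous_on (fun t : R => 0 <= t <= 1) lambda -> lambda 1 = 0 ->
  boundary_flow r lambda P ->
  Glb_Rbar (fun x : R => loewner_hull lambda 1 (RtoC x)) = Finite (P 0).
Proof.
  intros Hr Hc H1 HP. apply is_glb_Rbar_unique. split.
  - intros x Hx. simpl. destruct (Rle_lt_dec (P 0) x) as [H|H]; [exact H | exfalso].
    apply (hull_not_left_of_boundary_flow r lambda P (RtoC x) Hr HP Hx); simpl; [exact H|].
    apply Rmult_lt_0_compat; [lra | apply exp_pos].
  - intros b Hb. apply Hb. now apply (boundary_flow_in_hull r).
Qed.

Lemma hull_height_bound r lambda P z rho :
  0 < r < 1 / 2 -> boundary_flow r lambda P -> loewner_hull lambda 1 z ->
  0 < rho < 1 -> (Re z - P 0) ^ 2 + Im z ^ 2 = rho ^ 2 ->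
  Im z <= 2 * exp (2 / (1 - 2 * r)) * rpow rho (2 - 2 * r).
Proof.
  intros Hr HP [Him [Hz | [s [g [Hs [Hg Hlim]]]]]] Hrho Hz2.
  - exfalso. subst z. simpl in Hz2.
    assert (H := bf_gap _ _ _ HP 0 ltac:(lra)). rewrite Rminus_0_r, rpow_1 in H. nra.
  - assert (HF := swallowed_flow_of_solution r lambda P z s g HP Hs Hg Hlim).
    destruct Hg as [H0 _].
    assert (HB := swallowed_height_bound _ _ _ _ _ rho Hr HF Hrho). simpl in HB.
    rewrite Rmax_left, H0 in HB by lra. specialize (HB Hz2).
    set (k := exp (2 / (1 - 2 * r))). set (q := rpow rho (2 - 2 * r)).
    assert (Hk : exp (- (4 / (1 - 2 * r))) * (k * k) = 1).
    { unfold k. rewrite <- !exp_plus.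
      replace (- (4 / (1 - 2 * r)) + (2 / (1 - 2 * r) + 2 / (1 - 2 * r))) with 0
        by (field; lra).
      apply exp_0. }
    assert (Hk0 : 0 < k) by apply exp_pos.
    assert (Hq0 : 0 < q) by (apply rpow_gt_0; lra).
    (* the exponents compare because [4 r (1 - r) <= 1] *)
    assert (Hq : rpow rho (1 / r) <= q * q).
    { unfold q. rewrite <- rpow_plus by lra. apply rpow_exponent_le; [lra|].
      apply Rle_div_r; [lra|]. nra. }
    apply Rsqr_incr_0_var; [|nra]. unfold Rsqr.
    assert (Him2 : Im z * Im z * (exp (- (4 / (1 - 2 * r))) * (k * k)) <= 4 * (q * q) * (k * k)).
    { rewrite <- Rmult_assoc. apply Rmult_le_compat_r; [nra|]. lra. }
    rewrite Hk in Him2. lra.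
Qed.

(** * The tangential region *)

Theorem theorem1p1 :
  forall a r : R, 4 <= a -> 0 < r < 1 / 2 ->
  exists M : R, 0 < M /\
  forall lambda : R -> R,
    continuous_on (fun t : R => 0 <= t <= 1) lambda ->
    lambda 1 = 0 ->
    (forall t : R, 0 <= t <= 1 -> a * rpow (1 - t) r <= lambda t) ->
    let p := real (Glb_Rbar (fun x : R => loewner_hull lambda 1 (RtoC x))) in
    locally (RtoC p) (fun z : C =>
      loewner_hull lambda 1 z ->
      p <= Re z /\ 0 <= Im z <= M * rpow (Re z - p) (2 - 2 * r)).
Proof.
  intros a r Ha Hr.
  set (M0 := 2 * exp (2 / (1 - 2 * r))).
  assert (HM0 : 0 < M0) by (assert (H := exp_pos (2 / (1 - 2 * r))); unfold M0; lra).
  set (q := exp (- (1 / (1 - 2 * r)))).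
  assert (Hq : 0 < q < 1).
  { split; [apply exp_pos|]. apply Rlt_le_trans with (exp 0); [|rewrite exp_0; lra].
    apply exp_increasing.
    assert (0 < 1 / (1 - 2 * r)) by (apply Rdiv_lt_0_compat; lra). lra. }
  exists (M0 * rpow 2 (2 - 2 * r)).
  split; [apply Rmult_lt_0_compat; [exact HM0 | apply rpow_gt_0; lra]|].
  intros lambda Hc H1 Hlam.
  destruct (exists_boundary_flow a r lambda Ha Hr Hc Hlam) as [P HP].
  intros p. assert (Hp : p = P 0) by (unfold p; rewrite (hull_glb r lambda P Hr Hc H1 HP); reflexivity).
  clearbody p. subst p.
  (* the surplus power [rho^(1-2r)] makes heights negligible against widths *)
  assert (Hsmall : exists d : posreal, forall rho, 0 < rho < d ->
    M0 * rpow rho (1 - 2 * r) < q / 2).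
  { assert (He : 0 < q / (2 * M0)) by (apply Rdiv_lt_0_compat; lra).
    assert (Hcont : continuous (fun u => rpow u (1 - 2 * r)) 0) by (apply continuous_rpow; lra).
    destruct (proj1 (filterlim_locally _ _) Hcont (mkposreal _ He)) as [d Hd].
    exists d. intros rho Hrho.
    assert (H : Rabs (rpow rho (1 - 2 * r) - rpow 0 (1 - 2 * r)) < q / (2 * M0)).
    { apply Hd. change (Rabs (rho - 0) < d). apply Rabs_def1; lra. }
    rewrite (rpow_nonpos 0), Rminus_0_r in H by lra. apply Rabs_def2 in H.
    destruct H as [H _]. apply (Rmult_lt_compat_l M0) in H; [|exact HM0].
    replace (M0 * (q / (2 * M0))) with (q / 2) in H by (field; lra). exact H. }
  destruct Hsmall as [d Hd]. assert (Hd0 := cond_pos d).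
  assert (He : 0 < Rmin (d / 2) (1 / 2)) by (apply Rmin_pos; lra).
  exists (mkposreal _ He). intros z Hz Hhull.
  assert (HzR : Rabs (Re z - P 0) < Rmin (d / 2) (1 / 2)) by exact (proj1 Hz).
  assert (HzI : Rabs (Im z - 0) < Rmin (d / 2) (1 / 2)) by exact (proj2 Hz).
  assert (Him : 0 <= Im z) by apply Hhull.
  assert (Hm1 := Rmin_l (d / 2) (1 / 2)). assert (Hm2 := Rmin_r (d / 2) (1 / 2)).
  rewrite Rminus_0_r in HzI.
  set (x := Re z - P 0) in *. set (y := Im z) in *.
  set (rho := sqrt (x ^ 2 + y ^ 2)).
  assert (Hxy : 0 <= x ^ 2 + y ^ 2) by (assert (Hx2 := pow2_ge_0 x); assert (Hy2 := pow2_ge_0 y); lra).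
  assert (Hrho2 : rho ^ 2 = x ^ 2 + y ^ 2) by (unfold rho; apply pow2_sqrt, Hxy).
  assert (Hrho0 : 0 <= rho) by apply sqrt_pos.
  assert (HxA : x ^ 2 = Rabs x ^ 2) by (symmetry; apply pow2_abs).
  rewrite (Rabs_pos_eq y) in HzI by exact Him.
  assert (HA0 := Rabs_pos x).
  assert (Hrhole : rho <= Rabs x + y) by nra.
  destruct (Rle_lt_or_eq_dec 0 rho Hrho0) as [Hpos|Hzero].
  - assert (Hy := hull_height_bound r lambda P z rho Hr HP Hhull ltac:(lra) (eq_sym Hrho2)).
    fold M0 y in Hy.
    assert (Hy1 : y <= q / 2 * rho).
    { eapply Rle_trans; [exact Hy|].
      replace (2 - 2 * r) with (1 - 2 * r + 1) by ring. rewrite rpow_plus by lra.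
      rewrite (rpow_pos rho 1), Rpower_1 by lra. rewrite <- Rmult_assoc.
      apply Rmult_le_compat_r; [lra|]. apply Rlt_le, Hd. lra. }
    assert (Hxr : rho / 2 < Rabs x) by nra.
    assert (Hyx : y < Rabs x * q) by nra.
    assert (Hx : 0 < x).
    { destruct (Rtotal_order x 0) as [Hneg|[H0|Hp]]; [| |exact Hp]; exfalso.
      - rewrite Rabs_left in Hyx by exact Hneg.
        apply (hull_not_left_of_boundary_flow r lambda P z Hr HP Hhull); [unfold x in Hneg; lra|].
        fold y q. unfold x in Hyx. lra.
      - rewrite H0, Rabs_R0 in Hxr. lra. }
    rewrite Rabs_pos_eq in Hxr by lra.
    split; [unfold x in Hx; lra|]. split; [exact Him|].
    eapply Rle_trans; [exact Hy|]. rewrite Rmult_assoc.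
    apply Rmult_le_compat_l; [lra|].
    rewrite !rpow_pos by lra. rewrite Rpower_mult_distr by lra.
    apply Rle_Rpower_l; lra.
  - assert (x = 0 /\ y = 0) as [Hx0 Hy0] by (rewrite <- Hzero in Hrho2; split; nra).
    split; [unfold x in Hx0; lra|]. split; [exact Him|].
    rewrite Hy0. apply Rmult_le_pos; [|apply rpow_ge_0].
    apply Rmult_le_pos; [lra | apply rpow_ge_0].
Qed.
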